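(* Let $K$ be a field with an automorphic involution $a\mapsto\overline{a}$ (possibly the identity) and a nonarchimedean valuation $\nu:K\to\mathbb{R}\cup\{\infty\}$ with $\nu(\overline a)=\nu(a)$. Let $V$ be a finite-dimensional $K$-vector space equipped with one of: (i) a symplectic form (the involution is the identity and $b$ is a nondegenerate alternating bilinear form); (ii) a nondegenerate quadratic form $q$ with associated bilinear form $b$; (iii) a nondegenerate Hermitian form $b$, where the involution is not the identity. In case (iii) assume $\dim V$ is even. Assume $V$ has Witt index $n=\lfloor\dim V/2\rfloor$ and fix a basis $e_1,\dots,e_n,f_1,\dots,f_n$ (together with one more vector $g$ if $\dim V$ is odd) such that the planes $H_i=\mathrm{span}(e_i,f_i)$ are pairwise orthogonal with respect to $b$, $b(e_i,e_i)=b(f_i,f_i)=0$ (in case (ii): $q(e_i)=q(f_i)=0$), $b(e_i,f_i)=1$, and, if $\dim V$ is odd, $g$ is $b$-orthogonal to every $H_i$ with $b(g,g)\ne0$ (in case (ii): $q(g)\neq0$). Let $L$ be a maximal isotropic subspace of $V$ and let $M$ be an $n\times\dim V$ matrix whose rows form a basis of $L$, written in coordinates with respect to the ordered basis $(e_1,\dots,e_n,f_1,\dots,f_n[,g])$. For $S\subseteq[n]$ let $p_S(L)$ be the valuation of the determinant of the $n\times n$ submatrix of $M$ formed by the columns corresponding to $e_i$ for $i\in S$ and $f_i$ for $i\in[n]\setminus S$. Then $S\mapsto p_S(L)$ (i.e. $e_S\mapsto p_S(L)$ on $\{0,1\}^n$) is a valuated $\Delta$-matroid.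
   Context: A sesquilinear form is a biadditive $b:V\times V\to K$ with $b(\alpha x,\beta y)=\alpha\overline\beta b(x,y)$; it is nondegenerate if for every $x\neq0$ neither $b(x,\cdot)$ nor $b(\cdot,x)$ is identically zero; it is Hermitian if $b(x,y)=\overline{b(y,x)}$. A quadratic form is $q:V\to K$ for which there is a bilinear $b$ with $q(\alpha x+\beta y)=\alpha^2q(x)+\alpha\beta b(x,y)+\beta^2q(y)$ (so $b(x,y)=q(x+y)-q(x)-q(y)$, the associated bilinear form); $q$ is nondegenerate if there is no $x\ne0$ with $b(x,\cdot)\equiv0$ and $q(x)=0$. A subspace $W$ is isotropic if $b$ vanishes on $W\times W$ (in case (ii): if $q$ vanishes on $W$); the Witt index is the common dimension of maximal isotropic subspaces. $e_S=\sum_{i\in S}e_i\in\{0,1\}^n$ (standard basis vectors of $\mathbb{R}^n$). For $p:\{0,1\}^n\to\mathbb{R}\cup\{\infty\}$, let $\operatorname{dom}p=\{y:p(y)\ne\infty\}$, $P_p=\operatorname{conv}\{(y,p(y)):y\in\operatorname{dom}p\}$ and let the induced subdivision be the set of projections (deleting the last coordinate) of lower faces of $P_p$ (faces supported by hyperplanes whose inner normal has positive last coordinate). $p$ is a valuated $\Delta$-matroid if every edge of this subdivision has length (Hamming distance of endpoints) at most $2$. *)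

(* Defs.v *)
From HB Require Import structures.
From mathcomp Require Import all_boot all_order all_algebra.
From mathcomp Require Import boolp classical_sets reals constructive_ereal.

Set Implicit Arguments.
Unset Strict Implicit.
Unset Printing Implicit Defensive.

Import Order.TTheory GRing.Theory Num.Theory.
Local Open Scope ring_scope.

Section Valuation.
Local Open Scope ereal_scope.

Record valuation (K : fieldType) (R : realType) := Valuation {
  val_fun :> K -> \bar R;
  val_neq_ninfty : forall x, val_fun x != -oo;
  val_eq_pinfty : forall x, val_fun x = +oo <-> x = 0%R;
  valM : forall x y, val_fun (x * y)%R = val_fun x + val_fun y;
  valD : forall x y, Order.min (val_fun x) (val_fun y) <= val_fun (x + y)%R
}.

End Valuation.

Section Forms.
Variables (K : fieldType) (V : vectType K).

Definition form_nondegenerate (b : V -> V -> K) :=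
  forall x, x != 0 -> (exists y, b x y != 0) /\ (exists y, b y x != 0).

Definition form_alternating (b : V -> V -> K) := forall x, b x x = 0.

Definition quadratic_with_polar (q : V -> K) (b : V -> V -> K) :=
  forall (c d : K) (x y : V),
    q (c *: x + d *: y) = c ^+ 2 * q x + c * d * b x y + d ^+ 2 * q y.

Definition quadratic_nondegenerate (q : V -> K) (b : V -> V -> K) :=
  ~ exists x, [/\ x != 0, forall y, b x y = 0 & q x = 0].

Definition orthogonal_spaces (b : V -> V -> K) (U W : {vspace V}) :=
  forall x y, x \in U -> y \in W -> b x y = 0.

Variable sigma : involutive_rmorphism K.

Variant polar_form : Type :=
| SymplecticForm (b : {biscalar V}) of
    sigma =1 id & form_alternating b & form_nondegenerate b
| QuadraticForm (q : V -> K) (b : {biscalar V}) of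
    quadratic_with_polar q b & quadratic_nondegenerate q b
| HermitianForm (b : {hermitian_sym V for sigma}) of
    ~ (sigma =1 id) & form_nondegenerate b.

Implicit Types (phi : polar_form) (W L : {vspace V}).

Definition is_hermitian_form phi : bool :=
  if phi is HermitianForm _ _ _ then true else false.

Definition polar_bform phi : V -> V -> K :=
  match phi with
  | SymplecticForm b _ _ _ => b
  | QuadraticForm _ b _ _ => b
  | HermitianForm b _ _ => b
  end.

Definition polar_value phi (x : V) : K :=
  if phi is QuadraticForm q _ _ _ then q x else polar_bform phi x x.

Definition isotropic phi W : Prop :=
  if phi is QuadraticForm q _ _ _ then forall x, x \in W -> q x = 0
  else forall x y, x \in W -> y \in W -> polar_bform phi x y = 0.

Definition maximal_isotropic phi L : Prop :=
  isotropic phi L /\ forall W, isotropic phi W -> (L <= W)%VS -> W = L.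

Definition has_witt_index phi (n : nat) : Prop :=
  forall W, maximal_isotropic phi W -> \dim W = n.

(* The tuple g has size odd (\dim {:V}), i.e. it is empty when V has even     *)
(* dimension and consists of the single extra vector otherwise.               *)
Definition witt_basis phi (n : nat) (e f : n.-tuple V)
    (g : (odd (\dim {:V})).-tuple V) : Prop :=
  let b := polar_bform phi in
  let H (i : 'I_n) := <<[:: tnth e i; tnth f i]>>%VS in
  [/\ basis_of fullv (e ++ f ++ g),
      forall i j, i != j -> orthogonal_spaces b (H i) (H j),
      forall i, polar_value phi (tnth e i) = 0 /\
                polar_value phi (tnth f i) = 0,
      forall i, b (tnth e i) (tnth f i) = 1
    & forall w, w \in (g : seq V) ->
        (forall i, orthogonal_spaces b <[w]> (H i)) /\ polar_value phi w != 0].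

Definition row_vectors (m d : nat) (B : d.-tuple V) (M : 'M[K]_(m, d)) : seq V :=
  [seq \sum_(j < d) M i j *: tnth B j | i : 'I_m].

End Forms.

(* Columns 0..n-1 of M are those of the e_i, columns n..2n-1 those of the f_i. *)
Definition plucker_minor (K : fieldType) (n k : nat) (M : 'M[K]_(n, n + (n + k)))
    (S : {set 'I_n}) : K :=
  \det (colsub (fun i => if i \in S then lshift (n + k) i
                         else rshift n (lshift k i)) M).

Section Subdivision.
Variable R : realType.
Local Open Scope classical_set_scope.

Definition convex_hull (m : nat) (A : set 'rV[R]_m) : set 'rV[R]_m :=
  [set x | exists (k : nat) (w : 'I_k -> R) (a : 'I_k -> 'rV[R]_m),
    [/\ forall i, 0 <= w i, \sum_(i < k) w i = 1, forall i, A (a i)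
      & x = \sum_(i < k) w i *: a i]].

Definition dotv (m : nat) (u x : 'rV[R]_m) : R := \sum_(i < m) u 0 i * x 0 i.

(* The face of P cut out by its supporting hyperplane with inner normal u. *)
Definition face (m : nat) (P : set 'rV[R]_m) (u : 'rV[R]_m) : set 'rV[R]_m :=
  [set x | P x /\ forall y, P y -> dotv u x <= dotv u y].

Definition hamming (m : nat) (y z : 'rV[R]_m) : nat :=
  #|[pred i | y 0 i != z 0 i]|.

Variable n : nat.

Definition indicator (S : {set 'I_n}) : 'rV[R]_n := \row_i (i \in S)%:R.

Implicit Type p : {set 'I_n} -> \bar R.

Definition lifted_polytope p : set 'rV[R]_(n + 1) :=
  convex_hull [set x | exists2 S, p S != +oo%E &
                         x = row_mx (indicator S) (const_mx (fine (p S)))].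

Definition induced_subdivision p : set (set 'rV[R]_n) :=
  [set F | exists2 u : 'rV[R]_(n + 1), 0 < u 0 (rshift n ord0) &
             F = lsubmx @` face (lifted_polytope p) u].

Definition edge_between (F : set 'rV[R]_n) (y z : 'rV[R]_n) : Prop :=
  y != z /\ F = convex_hull [set y; z].

(* A function on {0,1}^n is given as a function on subsets S, with S standing *)
(* for indicator S. The first clause says that p takes values in R u {+oo}.   *)
Definition valuated_delta_matroid p : Prop :=
  (forall S, p S != -oo%E) /\
  forall F y z, induced_subdivision p F -> edge_between F y z ->
    (hamming y z <= 2)%N.

End Subdivision.

(* Main.v *)
(* An edge of the subdivision comes from a linear tilt of p with exactly two
   minimizers S and T. Row-reduce M on the columns selected by S; the remaining e/f-columns
   form a matrix A whose principal minors are the Plücker coordinates at S Δ D,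
   up to a common factor. The tilt gives weights w with val(det A_D) >= w(D),
   and with equality only for D = ∅ and D = S Δ T. If #(S Δ T) > 2, the 1x1 and
   2x2 principal minors exceed their weights, and isotropy of the rows turns this
   into val(A i j) > (w i + w j) / 2 for all i, j. Every Leibniz term of
   det A_(S Δ T) then has valuation > w(S Δ T): contradiction. *)
Require Import Defs.
From HB Require Import structures.
From mathcomp Require Import all_boot all_order all_fingroup all_algebra.
From mathcomp Require Import boolp classical_sets reals constructive_ereal.
From mathcomp Require Import ring lra.

Set Implicit Arguments.
Unset Strict Implicit.
Unset Printing Implicit Defensive.

Import Order.TTheory GRing.Theory Num.Theory.
Local Open Scope ring_scope.

(** * Valuation estimates for sums, products and determinants *)

Section ValuationTheory.
Variables (R : realType) (K : fieldType) (nu : valuation K R).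
Implicit Types (x y : K) (r s : R).

Lemma val_zero : nu 0 = +oo%E.
Proof. exact/val_eq_pinfty. Qed.

Lemma val_fin_num x : x != 0 -> nu x \is a fin_num.
Proof.
move=> /eqP x0; rewrite fin_numE val_neq_ninfty /=.
by apply/eqP => /val_eq_pinfty.
Qed.

Lemma val_ge_mul r s x y :
  (r%:E <= nu x -> s%:E <= nu y -> (r + s)%:E <= nu (x * y)%R)%E.
Proof. by move=> rx sy; rewrite Defs.valM EFinD leeD. Qed.

Lemma val_gt_mul r s x y :
  (r%:E < nu x -> s%:E <= nu y -> (r + s)%:E < nu (x * y)%R)%E.
Proof.
have := val_neq_ninfty nu x; have := val_neq_ninfty nu y.
rewrite Defs.valM; case: (nu x) => [x'| |]; case: (nu y) => [y'| |] //= _ _;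
  rewrite ?lte_fin ?lee_fin ?ltry // => rx sy; lra.
Qed.

Lemma val_gt_add (c : \bar R) x y :
  (c < nu x -> c < nu y -> c < nu (x + y)%R)%E.
Proof. by move=> cx cy; apply: lt_le_trans (Defs.valD nu x y); rewrite lt_min cx. Qed.

(** Doubling is injective on the reals, so [nu x + nu x = nu 1 = 0] forces [nu x = 0]. This handles
    [1], [-1] and the unit pairings [b (f_i) (e_i)] at once. *)
Lemma val_unit_sqr x : x * x = 1 -> nu x = 0%E.
Proof.
have v1 : nu 1 = 0%E.
  have := Defs.valM nu 1 1; rewrite mulr1.
  have := val_fin_num (oner_neq0 K); case: (nu 1) => // r _ [] rr.
  by congr EFin; lra.
move=> xx; have x0 : x != 0.
  by apply: contra_eq_neq xx => ->; rewrite mul0r eq_sym oner_neq0.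
have := Defs.valM nu x x; rewrite xx v1.
have := val_fin_num x0; case: (nu x) => // r _ [] rr.
by congr EFin; lra.
Qed.

Lemma val_opp x : nu (- x) = nu x.
Proof. by rewrite -mulN1r Defs.valM val_unit_sqr ?add0e // mulrNN mulr1. Qed.

Lemma val_gt_sub (c : \bar R) x y :
  (c < nu x -> c < nu y -> c < nu (x - y)%R)%E.
Proof. by move=> cx cy; apply: val_gt_add => //; rewrite val_opp. Qed.

Lemma val_gt_sum (I : Type) (l : seq I) (F : I -> K) (c : R) :
  (forall i, c%:E < nu (F i))%E -> (c%:E < nu (\sum_(i <- l) F i)%R)%E.
Proof.
move=> cF; elim/big_ind: _ => // [|x y]; first by rewrite val_zero ltry.
exact: val_gt_add.
Qed.

Lemma val_ge_prod (I : Type) (l : seq I) (P : pred I) (F : I -> K) (c : I -> R) :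
  (forall i, P i -> (c i)%:E <= nu (F i))%E ->
  ((\sum_(i <- l | P i) c i)%:E <= nu (\prod_(i <- l | P i) F i)%R)%E.
Proof.
move=> cF; apply: (@big_rec2 R K (fun r x => r%:E <= nu x)%E) => [|i r x Pi rx].
  by rewrite val_unit_sqr ?mulr1.
by apply: val_ge_mul => //; apply: cF.
Qed.

Lemma val_gt_half_eq r x y :
  nu x = nu y -> ((r *+ 2)%:E < nu (x * y)%R)%E -> (r%:E < nu x)%E.
Proof.
rewrite Defs.valM => <-; case: (nu x) => [x'| |] //=; rewrite ?lte_fin ?ltry //.
by move=> ?; lra.
Qed.

Lemma val_gt_half r x : ((r *+ 2)%:E < nu (x * x)%R)%E -> (r%:E < nu x)%E.
Proof. exact: val_gt_half_eq. Qed.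

(** Every Leibniz term uses each row and each column once, so its weights add up to the same total.
    Its factor from column [j0] makes the bound strict, and the ultrametric inequality passes the
    strict bound to the sum. *)
Lemma val_gt_det n (N : 'M[K]_n) (r c : 'I_n -> R) (j0 : 'I_n) :
  (forall i j, (r i + c j)%:E <= nu (N i j))%E ->
  (forall i, (r i + c j0)%:E < nu (N i j0))%E ->
  ((\sum_i r i + \sum_j c j)%:E < nu (\det N))%E.
Proof.
move=> Nge Ngt; rewrite /determinant; apply: val_gt_sum => s.
suff gt_s : ((\sum_i r i + \sum_j c j)%:E < nu (\prod_i N i (s i))%R)%E.
  by rewrite mulr_sign; case: ifP => _; rewrite ?val_opp.
rewrite [\sum_j c j](reindex_perm s) -big_split /=.
pose i0 := (s^-1)%g j0; have si0 : s i0 = j0 by rewrite permKV.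
rewrite (bigD1 i0) //= [X in nu X](bigD1 i0) //= si0.
by apply: val_gt_mul; [exact: Ngt|exact: val_ge_prod].
Qed.

End ValuationTheory.

(** * Lower edges of the lifted polytope, read as tilts with two minimizers *)

Section LowerEdges.
Variables (R : realType) (m : nat).
Implicit Types (A : set 'rV[R]_m) (u x y z : 'rV[R]_m).
Local Open Scope classical_set_scope.

Lemma sub_convex_hull A : A `<=` convex_hull A.
Proof.
move=> x Ax; exists 1%N, (fun=> 1), (fun=> x).
by rewrite !big_ord1 scale1r; split.
Qed.

(** The parameter [t] is the total weight placed on [z]. Its sign expresses that [y] is an extreme
    point of the segment. *)
Lemma convex_hull_pair y z x : convex_hull [set y; z] x ->
  exists2 t : R, 0 <= t & x = y + t *: (z - y).
Proof.
move=> [k [w [a [w0 w1 ayz ->]]]].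
exists (\sum_(i < k | a i == z) w i); first by apply: sumr_ge0.
have -> : \sum_(i < k) w i *: a i =
    \sum_(i < k) (w i *: y + (if a i == z then w i else 0) *: (z - y)).
  apply: eq_bigr => i _; case: ifPn => [/eqP ->|azN].
    by rewrite -scalerDr subrKC.
  by case: (ayz i) azN => -> //; rewrite ?eqxx // scale0r addr0.
by rewrite big_split /= -!scaler_suml w1 scale1r -big_mkcond.
Qed.

Lemma dotv_sum u k (w : 'I_k -> R) (a : 'I_k -> 'rV[R]_m) :
  dotv u (\sum_i w i *: a i) = \sum_i w i * dotv u (a i).
Proof.
rewrite /dotv; under [RHS]eq_bigr do rewrite mulr_sumr.
rewrite [RHS]exchange_big /=; apply: eq_bigr => j _.
rewrite summxE mulr_sumr; apply: eq_bigr => i _.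
by rewrite !mxE mulrCA.
Qed.

(** The minimum of the functional is a weighted average of its values at the [a i], none of which
    lies below it; hence every point of nonzero weight attains it. *)
Lemma face_convex_hull A u k (w : 'I_k -> R) (a : 'I_k -> 'rV[R]_m) :
    (forall i, 0 <= w i) -> \sum_i w i = 1 -> (forall i, A (a i)) ->
    face (convex_hull A) u (\sum_i w i *: a i) ->
  forall i, w i != 0 -> face (convex_hull A) u (a i).
Proof.
move=> w0 w1 Aa [_ minx] i wi; split; first exact: sub_convex_hull.
move=> x /minx; apply: le_trans.
set d := dotv u _ in minx *.
have da j : 0 <= dotv u (a j) - d by rewrite subr_ge0 minx//; apply: sub_convex_hull.
have : \sum_j w j * (dotv u (a j) - d) = 0.
  under eq_bigr do rewrite mulrBr.
  by rewrite sumrB -mulr_suml w1 mul1r -dotv_sum subrr.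
move=> /eqP; rewrite psumr_eq0 => [|j _]; last exact: mulr_ge0.
move=> /allP /(_ i); rewrite mem_index_enum => /(_ isT) /=.
by rewrite mulf_eq0 (negbTE wi) subr_eq0 => /eqP ->.
Qed.

End LowerEdges.

(** Some point of the face lies over [y]; expand it as a convex combination of generators. Those of
    nonzero weight lie in the face, so they project to [y + t_i (z - y)] with [t_i >= 0]. The
    average of the [t_i] is 0, hence each such [t_i] vanishes and the generator itself lies over
    [y]. *)
Lemma lower_edge_endpoint (R : realType) (n k : nat) (A : set 'rV[R]_(n + k))
    (u : 'rV[R]_(n + k)) (y z : 'rV[R]_n) : y != z ->
    (lsubmx @` face (convex_hull A) u = convex_hull [set y; z])%classic ->
  exists2 x, A x & face (convex_hull A) u x /\ lsubmx x = y.
Proof.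
move=> yz Fyz.
have /existsP[c yzc] : [exists c, z 0 c - y 0 c != 0].
  apply: contraNT yz; rewrite negb_exists => /forallP eqyz.
  apply/eqP/rowP => c; have := eqyz c; rewrite negbK subr_eq0 => /eqP ->//.
have : convex_hull [set y; z]%classic y by apply: sub_convex_hull; left.
rewrite -Fyz => -[x Fx xy].
have [[l [w [a [w0 w1 Aa xE]]]] _] := Fx; rewrite xE in Fx xy.
have Fa := face_convex_hull w0 w1 Aa Fx.
(* The coordinate [c], where [y] and [z] differ, recovers the segment parameter by an explicit
   formula that is linear in the point up to a constant. *)
pose t i := (lsubmx (a i) 0 c - y 0 c) / (z 0 c - y 0 c).
have ta i : w i != 0 -> 0 <= t i /\ lsubmx (a i) = y + t i *: (z - y).
  move=> /Fa Fai.
  have : convex_hull [set y; z]%classic (lsubmx (a i)) by rewrite -Fyz; exists (a i).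
  move=> /convex_hull_pair[s s0 ais].
  suff -> : t i = s by [].
  by rewrite /t ais !mxE addrAC subrr add0r mulfK.
have : \sum_i w i * t i = 0.
  under eq_bigr do rewrite mulrA mulrBr.
  rewrite -mulr_suml sumrB -mulr_suml w1 mul1r -xy mxE summxE.
  under eq_bigr do rewrite mxE.
  under [X in _ - X]eq_bigr do rewrite mxE.
  by rewrite subrr mul0r.
move=> /eqP; rewrite psumr_eq0 => [/allP wt|i _]; last first.
  have [->|wi] := eqVneq (w i) 0; first by rewrite mul0r.
  by have [ti0 _] := ta i wi; apply: mulr_ge0.
have /existsP[i wi] : [exists i, w i != 0].
  apply: contraTT (oner_neq0 R); rewrite negb_exists => /forallP w_eq0.
  rewrite -w1 negbK big1 // => i _; apply/eqP.
  by have := w_eq0 i; rewrite negbK.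
exists (a i) => //; split; first exact: Fa.
have [_ ->] := ta i wi.
have := wt i; rewrite mem_index_enum mulf_eq0 (negbTE wi) => /(_ isT) /eqP ->.
by rewrite scale0r addr0.
Qed.

Lemma dotv_lift (R : realType) (n : nat) (u : 'rV[R]_(n + 1)) (S : {set 'I_n}) (h : R) :
  dotv u (row_mx (indicator R S) (const_mx h)) =
  \sum_(i in S) u 0 (lshift 1 i) + u 0 (rshift n ord0) * h.
Proof.
rewrite /dotv big_split_ord big_ord1 row_mxEr mxE; congr (_ + _).
rewrite [RHS]big_mkcond; apply: eq_bigr => i _; rewrite row_mxEl mxE.
by case: (i \in S); rewrite ?mulr1 ?mulr0.
Qed.

Lemma indicator_inj (R : realType) (n : nat) : injective (@indicator R n).
Proof.
move=> S T /rowP ST; apply/setP => i; have := ST i; rewrite !mxE.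
by do 2!case: (_ \in _) => //; move/eqP; rewrite ?oner_eq0 // eq_sym oner_eq0.
Qed.

(** At an index where [S] and [T] differ, the right-hand side is [t] or [1 - t], while the left-hand
    side is 0 or 1. *)
Lemma indicator_segment (R : realType) (n : nat) (S T U : {set 'I_n}) (t : R) :
  S != T ->
  indicator R U = indicator R S + t *: (indicator R T - indicator R S) ->
  U = S \/ U = T.
Proof.
move=> ST UST.
suff [t0|t1] : t = 0 \/ t = 1.
- by left; apply: (@indicator_inj R); rewrite UST t0 scale0r addr0.
- by right; apply: (@indicator_inj R); rewrite UST t1 scale1r subrKC.
have /existsP[i] : [exists i, (i \in S) != (i \in T)].
  apply: contraNT ST; rewrite negb_exists => /forallP ST.
  by apply/eqP/setP => i; apply/eqP; have := ST i; rewrite negbK.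
have /rowP/(_ i) := UST; rewrite !mxE.
case: (i \in S); case: (i \in T); case: (i \in U) => //= tE _;
  by [left; lra|right; lra].
Qed.

(** This is an inner normal with last coordinate 1, evaluated at the lifted point over [S]. Since
    [fine] sends [+oo] to 0, the value has this meaning only where [p S] is finite. *)
Definition tilted (R : realType) (n : nat) (p : {set 'I_n} -> \bar R)
    (c : 'I_n -> R) (S : {set 'I_n}) : R :=
  \sum_(i in S) c i + fine (p S).

(** Dividing the inner normal by its positive last coordinate gives the tilt [c]. The endpoints are
    lifted generators in the face, hence minimizers. *)
Lemma lower_edge_tilted (R : realType) (n : nat) (p : {set 'I_n} -> \bar R) F y z :
    induced_subdivision p F -> edge_between F y z ->
  exists (S T : {set 'I_n}) (c : 'I_n -> R),
    [/\ y = indicator R S /\ z = indicator R T,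
        p S != +oo%E, p T != +oo%E,
        tilted p c S = tilted p c T &
        forall U, p U != +oo%E -> U != S -> U != T -> tilted p c S < tilted p c U].
Proof.
move=> [u u0 ->] [yz]; rewrite /lifted_polytope.
set A := [set x | _]%classic => Fyz.
have Fzy : (lsubmx @` face (convex_hull A) u = convex_hull [set z; y])%classic.
  by rewrite Fyz setUC.
have [_ [S pS ->] [FS]] := lower_edge_endpoint yz Fyz; rewrite row_mxKl => yS.
have zy : z != y by rewrite eq_sym.
have [_ [T pT ->] [FT]] := lower_edge_endpoint zy Fzy; rewrite row_mxKl => zT.
pose c i := u 0 (lshift 1 i) / u 0 (rshift n ord0).
have tE U : tilted p c U =
    dotv u (row_mx (indicator R U) (const_mx (fine (p U)))) / u 0 (rshift n ord0).
  by rewrite dotv_lift mulrDl mulrAC divff ?gt_eqF // mul1r mulr_suml.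
have hull U : p U != +oo%E ->
    convex_hull A (row_mx (indicator R U) (const_mx (fine (p U)))).
  by move=> pU; apply: sub_convex_hull; exists U.
exists S, T, c; split=> // [|U pU US UT].
  rewrite !tE; congr (_ / _); apply/eqP; rewrite eq_le.
  by rewrite (FS.2 _ (hull _ pT)) (FT.2 _ (hull _ pS)).
rewrite !tE ltr_pM2r ?invr_gt0 // lt_neqAle (FS.2 _ (hull _ pU)) andbT.
(* A third minimizer [U] would put its lifted point in the face and so its indicator on the segment,
   whose only 0/1 points are the endpoints. *)
apply/eqP => SU.
have FU : face (convex_hull A) u (row_mx (indicator R U) (const_mx (fine (p U)))).
  by split; [exact: hull|rewrite -SU; exact: FS.2].
have : convex_hull [set y; z]%classic (indicator R U).
  rewrite -Fyz; exists (row_mx (indicator R U) (const_mx (fine (p U)))) => //.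
  exact: row_mxKl.
move=> /convex_hull_pair[t _]; rewrite -yS -zT => /indicator_segment.
case=> [|/eqP|/eqP]; rewrite ?(negbTE US) ?(negbTE UT) //.
by apply: contraNneq yz; rewrite -yS -zT => ->.
Qed.

(** * Principal minors as determinants of full size *)

Section PrincipalMinors.
Variables (K : fieldType) (n : nat).
Implicit Types (A : 'M[K]_n) (D : {set 'I_n}).

(** Its determinant is the principal minor of [A] on [D]; keeping the size [n] avoids reindexing by
    [D]. *)
Definition fill_id A D : 'M[K]_n := \matrix_(i, j) if j \in D then A i j else (i == j)%:R.

(** A column outside [D] has its only nonzero entry on the diagonal, so a surviving Leibniz term
    fixes every index outside [D]. *)
Lemma prod_fill_id_neq0 A D (s : 'S_n) :
  \prod_i fill_id A D i (s i) != 0 -> perm_on D s.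
Proof.
move=> prod_neq0; apply/fintype.subsetP => i; rewrite inE; apply: contraNT => iD.
rewrite prodf_seq_neq0 in prod_neq0.
have /allP/(_ ((s^-1)%g i)) := prod_neq0.
rewrite mem_index_enum permKV mxE (negbTE iD) => /(_ isT).
case: ((s^-1)%g i =P i) => [si _|_]; last by rewrite eqxx.
by rewrite -{1}si permKV.
Qed.

Lemma det_fill_id1 A i : \det (fill_id A [set i]) = A i i.
Proof.
rewrite /determinant (bigD1 1%g) //= [X in _ + X]big1 ?addr0 => [|s s1].
  rewrite odd_perm1 mul1r (bigD1 i) //= perm1 mxE set11 big1 ?mulr1 // => k ki.
  by rewrite perm1 mxE inE (negbTE ki) eqxx.
apply/eqP; rewrite mulf_eq0; apply/orP; right.
apply: contraNT s1 => /prod_fill_id_neq0 sD.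
have fix_out k : k != i -> s k = k by move=> ki; apply: (out_perm sD); rewrite inE.
apply/eqP/permP => k; rewrite perm1; have [->|/fix_out//] := eqVneq k i.
by apply/eqP/negPn/negP => sii; have /perm_inj/eqP := fix_out _ sii; rewrite (negbTE sii).
Qed.

Lemma det_fill_id2 A i j : i != j ->
  \det (fill_id A [set i; j]) = A i i * A j j - A i j * A j i.
Proof.
move=> ij; have ji : j != i by rewrite eq_sym.
rewrite /determinant (bigD1 1%g) //= (bigD1 (tperm i j)) /=; last first.
  apply: contraNneq ij => /permP/(_ i); rewrite tpermL perm1 => ->.
  by rewrite eqxx.
rewrite [X in _ + (_ + X)]big1 ?addr0 => [|s /andP[s1 st]].
  rewrite odd_perm1 mul1r odd_tperm ij expr1 mulN1r.
  congr (_ - _); rewrite (bigD1 i) //= (bigD1 j) //= mulrA big1 ?mulr1 =>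
    [|k /andP[ki kj]].
  - by rewrite !perm1 !mxE !inE !eqxx orbT.
  - by rewrite perm1 mxE !inE (negbTE ki) (negbTE kj) eqxx.
  - by rewrite tpermL tpermR !mxE !inE !eqxx orbT.
  - by rewrite tpermD 1?eq_sym // mxE !inE (negbTE ki) (negbTE kj) eqxx.
apply/eqP; rewrite mulf_eq0; apply/orP; right.
apply/negPn/negP => /prod_fill_id_neq0 sD.
have fix_out k : k != i -> k != j -> s k = k.
  by move=> ki kj; apply: (out_perm sD); rewrite !inE negb_or ki.
have sP k : k \in [set i; j] -> s k \in [set i; j].
  by rewrite -(perm_closed k sD).
have [sii|sii] := eqVneq (s i) i.
  case/negP: s1; apply/eqP/permP => k; rewrite perm1.
  have [->//|ki] := eqVneq k i; have [->|/(fix_out _ ki)//] := eqVneq k j.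
  have := sP j; rewrite !inE eqxx orbT => /(_ isT) /orP[/eqP sji|/eqP//].
  by case/eqP: ij; apply: (@perm_inj _ s); rewrite sii sji.
have sij : s i = j by have := sP i; rewrite !inE eqxx (negbTE sii) => /(_ isT) /eqP.
have sji : s j = i.
  have := sP j; rewrite !inE eqxx orbT => /(_ isT) /orP[/eqP//|/eqP sjj].
  by case/eqP: ij; apply: (@perm_inj _ s); rewrite sij sjj.
case/negP: st; apply/eqP/permP => k.
case: tpermP => [->|->|/eqP ki /eqP kj] //.
exact: fix_out.
Qed.

End PrincipalMinors.

(** * Plücker coordinates as principal minors in the chart of [S] *)

Section ChartMinors.
Variables (K : fieldType) (n k : nat).
Implicit Types (M : 'M[K]_(n, n + (n + k))) (S D : {set 'I_n}).

Definition chart_col S (i : 'I_n) : 'I_(n + (n + k)) :=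
  if i \in S then lshift (n + k) i else rshift n (lshift k i).

Definition symdiff S D : {set 'I_n} := [set i | (i \in S) (+) (i \in D)].

Lemma symdiffK S D : symdiff S (symdiff S D) = D.
Proof. by apply/setP => i; rewrite !inE addKb. Qed.

Lemma plucker_minor_mul (C : 'M[K]_n) M S :
  plucker_minor (C *m M) S = \det C * plucker_minor M S.
Proof.
rewrite /plucker_minor -det_mulmx; congr (\det _).
by apply/matrixP => i j; rewrite !mxE; apply: eq_bigr => l _; rewrite !mxE.
Qed.

(** Passing from [S] to its symmetric difference with [D] exchanges the [e] and [f] columns exactly
    at the indices in [D]. Each column keeps its position, so no sign appears. *)
Lemma plucker_minor_chart M S D : colsub (chart_col S) M = 1%:M ->
  plucker_minor M (symdiff S D) = \det (fill_id (colsub (chart_col (~: S)) M) D).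
Proof.
move=> MS; congr (\det _); apply/matrixP => i j.
have /matrixP/(_ i j) := MS; rewrite !mxE /chart_col !inE.
by case: (j \in S); case: (j \in D).
Qed.

End ChartMinors.

(** * Sesquilinear and quadratic forms in hyperbolic coordinates *)

Section HyperbolicCoordinates.
Variables (K : fieldType) (V : vectType K) (theta : K -> K) (act : K -> K -> K).
Hypothesis actE : forall a x, act a x = theta a * x.
Variables (b : {bilinear V -> V -> K | *%R & act}) (n : nat) (s t : 'I_n -> V).
Hypothesis ss0 : forall i j, b (s i) (s j) = 0.
Hypothesis tt0 : forall i j, b (t i) (t j) = 0.
Hypothesis st0 : forall i j, i != j -> b (s i) (t j) = 0.
Hypothesis ts0 : forall i j, i != j -> b (t i) (s j) = 0.

(** The [s] and the [t] each span a totally isotropic space, and [s l] pairs only with [t l], so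
    just two cross terms survive besides the part orthogonal to the planes. A general [theta] treats
    bilinear and Hermitian forms together. *)
Lemma hyperbolic_form_chart (i j : 'I_n) (a a' : 'I_n -> K) (h h' : V) :
    (forall l, b h (s l) = 0 /\ b h (t l) = 0) ->
    (forall l, b (s l) h' = 0 /\ b (t l) h' = 0) ->
  b (s i + \sum_l a l *: t l + h) (s j + \sum_l a' l *: t l + h') =
  a j * b (t j) (s j) + theta (a' i) * b (s i) (t i) + b h h'.
Proof.
move=> h0 h'0; set x := s i + _ + h.
have xs : b x (s j) = a j * b (t j) (s j).
  rewrite !linearDl ss0 (h0 j).1 add0r addr0 linear_sumlz (bigD1 j) //= big1 ?addr0.
    by rewrite linearZl_LR.
  by move=> l lj; rewrite linearZl_LR ts0 // mulr0.
have xt l : b x (t l) = b (s i) (t l).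
  rewrite !linearDl (h0 l).2 addr0 linear_sumlz big1 ?addr0 // => m _.
  by rewrite linearZl_LR tt0 mulr0.
have xh : b x h' = b h h'.
  rewrite !linearDl (h'0 i).1 add0r linear_sumlz big1 ?add0r // => m _.
  by rewrite linearZl_LR (h'0 m).2 mulr0.
rewrite !linearDr xs xh; congr (_ + _ + _).
rewrite linear_sumr (bigD1 i) //= big1 ?addr0 => [|l li].
  by rewrite linearZr_LR actE xt.
by rewrite linearZr_LR actE xt st0 ?mulr0 // eq_sym.
Qed.

End HyperbolicCoordinates.

Section QuadraticForms.
Variables (K : fieldType) (V : vectType K) (q : V -> K) (b : {biscalar V}).
Hypothesis qb : quadratic_with_polar q b.

Lemma quadraticD x y : q (x + y) = q x + b x y + q y.
Proof. by have := qb 1 1 x y; rewrite !scale1r !expr1n !mul1r. Qed.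

Lemma quadraticZ c x : q (c *: x) = c ^+ 2 * q x.
Proof. by have := qb c 0 x 0; rewrite scale0r addr0 expr0n !mulr0 !mul0r !addr0. Qed.

Lemma polarC x y : b x y = b y x.
Proof.
have bE u v : b u v = q (u + v) - q u - q v by rewrite quadraticD; ring.
by rewrite !bE (addrC y x) addrAC.
Qed.

Lemma polar_diag x : b x x = q x *+ 2.
Proof.
have := quadraticD x x; rewrite -mulr2n -scaler_nat quadraticZ => bE.
by apply: (addrI (q x)); apply: (addIr (q x)); rewrite -bE; ring.
Qed.

Variables (n : nat) (s t : 'I_n -> V).
Hypothesis qs0 : forall i, q (s i) = 0.
Hypothesis qt0 : forall i, q (t i) = 0.
Hypothesis tt0 : forall i j, b (t i) (t j) = 0.
Hypothesis st0 : forall i j, i != j -> b (s i) (t j) = 0.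

(** The form [q] vanishes on the span of the [t], since the generators are singular and mutually
    orthogonal; only the pairing of [s i] with its partner and [q h] remain. *)
Lemma quadratic_chart (i : 'I_n) (a : 'I_n -> K) (h : V) :
    (forall l, b (s l) h = 0 /\ b (t l) h = 0) ->
  q (s i + \sum_l a l *: t l + h) = a i * b (s i) (t i) + q h.
Proof.
move=> h0; set y := \sum_l _.
have [qy ty] : q y = 0 /\ forall l, b (t l) y = 0.
  rewrite /y; elim/big_rec: _ => [|l y' _ [qy' ty']].
    split=> [|l]; last by rewrite linear0r.
    by rewrite -(scale0r 0) quadraticZ expr0n mul0r.
  split=> [|m].
    by rewrite quadraticD quadraticZ qt0 qy' linearZl_LR ty' !mulr0 !addr0.
  by rewrite linearDr linearZr_LR tt0 ty' mulr0 addr0.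
have sy : b (s i) y = a i * b (s i) (t i).
  rewrite linear_sumr (bigD1 i) //= big1 ?addr0 ?linearZr_LR // => l li.
  by rewrite linearZr_LR st0 ?mulr0 // eq_sym.
have yh : b y h = 0.
  by rewrite linear_sumlz big1 // => l _; rewrite linearZl_LR (h0 l).2 mulr0.
by rewrite !quadraticD qs0 qy sy linearDl (h0 i).1 yh !addr0 add0r.
Qed.

End QuadraticForms.

(* The diagonal bounds control [d := g x y] because [d^2 = a11 a22]; the
   determinant is the square of [a12 + d], the alternating part. *)
Lemma val_gt_offdiag_quadratic (R : realType) (K : fieldType) (nu : valuation K R)
    (r : R) (a11 a12 a21 a22 g x y : K) :
    a11 + x ^+ 2 * g = 0 -> a22 + y ^+ 2 * g = 0 ->
    a12 + a21 + x * y * (g *+ 2) = 0 ->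
    ((r *+ 2)%:E < nu (a11 * a22)%R)%E ->
    ((r *+ 2)%:E < nu (a11 * a22 - a12 * a21)%R)%E ->
  (r%:E < nu a12)%E.
Proof.
move=> /addr0_eq a11E /addr0_eq a22E /(canRL (addrK _)); rewrite sub0r.
move=> /(canRL (addKr _)) a21E gt_diag gt_det.
have -> : a12 = (a12 + x * y * g) - x * y * g by rewrite addrK.
apply: val_gt_sub; apply: val_gt_half.
  suff -> : (a12 + x * y * g) * (a12 + x * y * g) = a11 * a22 - a12 * a21 by [].
  have -> : a11 = - (x ^+ 2 * g) by rewrite -a11E opprK.
  have -> : a22 = - (y ^+ 2 * g) by rewrite -a22E opprK.
  by rewrite a21E; ring.
suff -> : (x * y * g) * (x * y * g) = a11 * a22 by [].
have -> : a11 = - (x ^+ 2 * g) by rewrite -a11E opprK.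
have -> : a22 = - (y ^+ 2 * g) by rewrite -a22E opprK.
by ring.
Qed.

(** * Off-diagonal entries of the chart matrix of an isotropic subspace *)

Section IsotropicCharts.
Variables (R : realType) (K : fieldType) (sigma : involutive_rmorphism K).
Variables (nu : valuation K R) (nu_sigma : forall a : K, nu (sigma a) = nu a).
Variables (V : vectType K) (phi : polar_form V sigma).
Hypothesis dim_hermitian : is_hermitian_form phi -> ~~ odd (\dim {:V}).
Variables (n : nat) (e f : n.-tuple V) (g : (odd (\dim {:V})).-tuple V).
Hypothesis basis_efg : witt_basis phi e f g.
Variables (L : {vspace V}) (L_iso : isotropic phi L).
Local Notation k := (odd (\dim {:V}) : nat).
Variables (N : 'M[K]_(n, n + (n + k))) (S : {set 'I_n}).
Hypothesis NL : forall i, \sum_j N i j *: tnth [tuple of e ++ f ++ g] j \in L.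
Hypothesis NS : colsub (chart_col k S) N = 1%:M.

(** The vectors [s i] are the pivots selected by [S] and the [t i] their hyperbolic partners. The
    matrix [A] holds the coordinates along the [t l], and [h i] is the component along [g], an empty
    sum when the dimension is even. *)
Let A := colsub (chart_col k (~: S)) N.
Let s i := if i \in S then tnth e i else tnth f i.
Let t i := if i \in S then tnth f i else tnth e i.
Let h i := \sum_(l < k) N i (rshift n (rshift n l)) *: tnth g l.

Lemma chart_rowE i :
  \sum_j N i j *: tnth [tuple of e ++ f ++ g] j = s i + \sum_l A i l *: t l + h i.
Proof.
rewrite big_split_ord /= big_split_ord /= addrA; congr (_ + _); last first.
  by apply: eq_bigr => l _; rewrite !tnth_rshift.
have -> : s i = \sum_l (i == l)%:R *: s l.
  rewrite (bigD1 i) //= eqxx scale1r big1 ?addr0 // => l li.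
  by rewrite eq_sym (negbTE li) scale0r.
rewrite -!big_split /=; apply: eq_bigr => l _.
have /matrixP/(_ i l) := NS; rewrite !mxE => <-.
rewrite tnth_lshift tnth_rshift tnth_lshift /chart_col /s /t inE.
by case: (l \in S) => //=; rewrite addrC.
Qed.

Lemma chart_in_plane i :
  s i \in <<[:: tnth e i; tnth f i]>>%VS /\ t i \in <<[:: tnth e i; tnth f i]>>%VS.
Proof.
by split; apply: memv_span; rewrite !inE /s /t; case: ifP; rewrite eqxx ?orbT.
Qed.

Lemma chart_orthogonal i j : i != j ->
  [/\ polar_bform phi (s i) (s j) = 0, polar_bform phi (t i) (t j) = 0,
      polar_bform phi (s i) (t j) = 0 & polar_bform phi (t i) (s j) = 0].
Proof.
have [_ orth _ _ _] := basis_efg => ij.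
have [si ti] := chart_in_plane i; have [sj tj] := chart_in_plane j.
by split; apply: orth ij _ _ _ _.
Qed.

Lemma chart_value i : polar_value phi (s i) = 0 /\ polar_value phi (t i) = 0.
Proof.
have [_ _ /(_ i)[e0 f0] _ _] := basis_efg.
by rewrite /s /t; case: ifP.
Qed.

(** The product [A i j * A j i] is a difference of two elements of valuation above [w i + w j]. In
    the symplectic and Hermitian cases both factors have the same valuation, so each gets half of
    the bound; in the quadratic case the contribution of [g] is separated first. *)
Lemma val_gt_offdiag (w : 'I_n -> R) :
    (forall i, (w i)%:E < nu (A i i))%E ->
    (forall i j, i != j -> (w i + w j)%:E < nu (A i i * A j j - A i j * A j i)%R)%E ->
  forall i j, (((w i + w j) / 2)%:E < nu (A i j))%E.
Proof.
move=> gt1 gt2 i j.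
have [<-|ij] := eqVneq i j; first by rewrite mulrDl -splitr.
have gtM : ((((w i + w j) / 2) *+ 2)%:E < nu (A i i * A j j)%R)%E.
  by rewrite -mulr_natr divfK ?pnatr_eq0 //; apply: val_gt_mul => //; apply: ltW.
have gtD : ((((w i + w j) / 2) *+ 2)%:E < nu (A i i * A j j - A i j * A j i)%R)%E.
  by rewrite -mulr_natr divfK ?pnatr_eq0 //; apply: gt2.
(* Without an anisotropic part, isotropy makes [A i j] and [A j i] agree up to
   [sigma] and signs. *)
have sesqui (act : K -> K -> K) (b : {bilinear V -> V -> K | *%R & act}) :
    (forall a x, act a x = sigma a * x) -> polar_bform phi = b :> (_ -> _ -> _) ->
    (forall x, polar_value phi x = b x x) -> (forall l, h l = 0) ->
    (forall x y, x \in L -> y \in L -> b x y = 0) ->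
    (forall l, b (tnth f l) (tnth e l) * b (tnth f l) (tnth e l) = 1) ->
  (((w i + w j) / 2)%:E < nu (A i j))%E.
  move=> actE phib phiv h0 bL bfe.
  have bef l : b (tnth e l) (tnth f l) = 1.
    by have [_ _ _ /(_ l)] := basis_efg; rewrite phib.
  have ss l m : b (s l) (s m) = 0.
    have [<-|/chart_orthogonal[]] := eqVneq l m; last by rewrite phib.
    by rewrite -phiv (chart_value l).1.
  have tt l m : b (t l) (t m) = 0.
    have [<-|/chart_orthogonal[]] := eqVneq l m; last by rewrite phib.
    by rewrite -phiv (chart_value l).2.
  have st l m : l != m -> b (s l) (t m) = 0.
    by move=> /chart_orthogonal[]; rewrite phib.
  have ts l m : l != m -> b (t l) (s m) = 0.
    by move=> /chart_orthogonal[]; rewrite phib.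
  (* Recording squares covers both signs: [b (f_l) (e_l)] is -1 in the symplectic case and 1 in the
     Hermitian case. *)
  have units l : b (s l) (t l) * b (s l) (t l) = 1 /\ b (t l) (s l) * b (t l) (s l) = 1.
    by rewrite /s /t; case: ifP; rewrite bfe bef mulr1.
  have := bL _ _ (NL i) (NL j); rewrite !chart_rowE !h0.
  rewrite (hyperbolic_form_chart actE ss tt st ts);
    try by move=> l; rewrite ?linear0l ?linear0r.
  rewrite linear0r addr0 => /addr0_eq Aij.
  apply: val_gt_half_eq (A j i) _ _.
    rewrite -(nu_sigma (A j i)).
    rewrite -[LHS]adde0 -(val_unit_sqr nu (units j).2) -Defs.valM.
    rewrite -[RHS]adde0 -(val_unit_sqr nu (units i).1) -Defs.valM.
    by rewrite -Aij val_opp.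
  have -> : A i j * A j i = A i i * A j j - (A i i * A j j - A i j * A j i) by ring.
  exact: val_gt_sub.
have h_nil (l : 'I_n) : (forall m : 'I_k, False) -> h l = 0.
  by move=> k0; rewrite /h big1 // => m; case: (k0 m).
have [_ _ _ bef gorth] := basis_efg.
have iso := L_iso; have herm := dim_hermitian.
case phiE : phi => [b sid alt nd|q b qb nd|b sid nd].
- rewrite phiE /= in iso gorth bef.
  apply: (sesqui _ b); rewrite ?phiE //.
  + by move=> a x; rewrite sid.
  (* An alternating form vanishes on the diagonal, so no vector can satisfy the condition imposed on
     [g]. *)
  + by move=> l; apply: h_nil => m; have [_ /eqP[]] := gorth _ (mem_tnth m g); exact: alt.
  + move=> l; have := alt (tnth e l + tnth f l).
    rewrite linearDl !linearDr !alt add0r addr0 bef => /addr0_eq <-.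
    by rewrite mulrNN mulr1.
- rewrite phiE /= in iso gorth bef.
  have bC := polarC qb.
  have qs l : q (s l) = 0 by have := (chart_value l).1; rewrite phiE.
  have qt l : q (t l) = 0 by have := (chart_value l).2; rewrite phiE.
  have ss l m : b (s l) (s m) = 0.
    have [<-|/chart_orthogonal[]] := eqVneq l m; last by rewrite phiE.
    by rewrite (polar_diag qb) qs mul0rn.
  have tt l m : b (t l) (t m) = 0.
    have [<-|/chart_orthogonal[]] := eqVneq l m; last by rewrite phiE.
    by rewrite (polar_diag qb) qt mul0rn.
  have st l m : l != m -> b (s l) (t m) = 0.
    by move=> /chart_orthogonal[]; rewrite phiE.
  have ts l m : l != m -> b (t l) (s m) = 0.
    by move=> /chart_orthogonal[]; rewrite phiE.
  have st1 l : b (s l) (t l) = 1.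
    by rewrite /s /t; case: ifP => _; rewrite ?bef // bC bef.
  have hs l m : b (h l) (s m) = 0 /\ b (h l) (t m) = 0.
    have [sm tm] := chart_in_plane m.
    split; rewrite linear_sumlz big1 // => r _; rewrite linearZl_LR;
      by rewrite ((gorth _ (mem_tnth r g)).1 m) ?memv_line ?mulr0.
  have sh l m : b (s m) (h l) = 0 /\ b (t m) (h l) = 0.
    by rewrite !(bC _ (h l)); exact: hs.
  (* The anisotropic part has dimension at most 1: [v] is the vector of [g] in odd dimension and 0
     in even dimension, so one computation serves both. *)
  have [v [x hE]] : exists v (x : 'I_n -> K), forall l, h l = x l *: v.
    have [oddV|evenV] := boolP (odd (\dim {:V})); last first.
      exists 0, (fun=> 0) => l; rewrite scaler0; apply: h_nil => m.
      by have := leq_ltn_trans (leq0n _) (ltn_ord m); rewrite (negbTE evenV).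
    have k1 : (0 < k)%N by rewrite oddV.
    exists (tnth g (Ordinal k1)), (fun l => N l (rshift n (rshift n (Ordinal k1)))) => l.
    rewrite /h (bigD1 (Ordinal k1)) //= big1 ?addr0 // => m /eqP[].
    apply: val_inj => /=; have := leq_trans (ltn_ord m) (leq_b1 _).
    by rewrite ltnS leqn0 => /eqP.
  have diag l : A l l + x l ^+ 2 * q v = 0.
    have := iso _ (NL l); rewrite chart_rowE (quadratic_chart qb qs qt tt st) //.
    by rewrite st1 mulr1 hE (quadraticZ qb).
  have offdiag : A i j + A j i + x i * x j * (q v *+ 2) = 0.
    have idE (a y : K) : a * y = idfun a * y by [].
    have := iso _ (memvD (NL i) (NL j)).
    rewrite (quadraticD qb) (iso _ (NL i)) (iso _ (NL j)) addr0 add0r !chart_rowE.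
    rewrite (hyperbolic_form_chart idE ss tt st ts) // st1 bC st1 !mulr1 !hE.
    by rewrite linearZl_LR linearZr_LR (polar_diag qb) mulrA.
  exact: (val_gt_offdiag_quadratic (diag i) (diag j) offdiag).
- rewrite phiE /= in iso herm bef.
  apply: (sesqui _ b); rewrite ?phiE //.
  + move=> l; apply: h_nil => m; have := leq_ltn_trans (leq0n _) (ltn_ord m).
    by rewrite (negbTE (herm isT)).
  + move=> l; have fe : b (tnth f l) (tnth e l) = 1.
      by rewrite (hermC b) /= bef rmorph1 expr0 mulr1.
    by rewrite [X in X * X]fe mulr1.
Qed.


End IsotropicCharts.

(** * From a long edge to a contradiction *)

Lemma sum_symdiff (R : realType) (n : nat) (c : 'I_n -> R) (S D : {set 'I_n}) :
  \sum_(i in symdiff S D) c i =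
  \sum_(i in S) c i + \sum_(i in D) (if i \in S then - c i else c i).
Proof.
rewrite [LHS]big_mkcond [X in X + _]big_mkcond [X in _ + X]big_mkcond -big_split /=.
apply: eq_bigr => i _; rewrite inE.
by case: (i \in S); case: (i \in D); rewrite ?subrr ?addr0 ?add0r.
Qed.

Lemma hamming_indicator (R : realType) (n : nat) (S T : {set 'I_n}) :
  hamming (indicator R S) (indicator R T) = #|symdiff S T|.
Proof.
apply: eq_card => i; rewrite !inE !mxE.
by do 2!case: (i \in _); rewrite /= ?eqxx ?oner_eq0 // eq_sym oner_eq0.
Qed.

Theorem theorem7p2 (R : realType) (K : fieldType)
    (sigma : involutive_rmorphism K)
    (nu : valuation K R) (nu_sigma : forall a : K, nu (sigma a) = nu a)
    (V : vectType K) (phi : polar_form V sigma)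
    (dim_hermitian : is_hermitian_form phi -> ~~ odd (\dim {:V}))
    (n : nat) (n_def : n = (\dim {:V})./2)
    (witt_index_n : has_witt_index phi n)
    (e f : n.-tuple V) (g : (odd (\dim {:V})).-tuple V)
    (basis_efg : witt_basis phi e f g)
    (L : {vspace V}) (L_max : maximal_isotropic phi L)
    (M : 'M[K]_(n, n + (n + odd (\dim {:V}))))
    (M_basis : basis_of L (row_vectors [tuple of e ++ f ++ g] M)) :
  valuated_delta_matroid (fun S : {set 'I_n} => nu (plucker_minor M S)).
Proof.
split=> [S|F y z subF edgeF]; first exact: val_neq_ninfty.
have [S [T [c [[-> ->] pS pT cST cmin]]]] := lower_edge_tilted subF edgeF.
rewrite hamming_indicator leqNgt; apply/negP => D3.
have [L_iso _] := L_max.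
set MS := colsub (chart_col (odd (\dim {:V})) S) M.
(* Finiteness of [p] at [S] is what permits row reduction on the columns of [S]. *)
have MS0 : \det MS != 0 by apply: contraNneq pS => /(val_eq_pinfty nu) /eqP.
have MSu : MS \in unitmx by rewrite unitmxE unitfE.
pose N := invmx MS *m M.
have NL i : \sum_j N i j *: tnth [tuple of e ++ f ++ g] j \in L.
  have -> : \sum_j N i j *: tnth [tuple of e ++ f ++ g] j =
      \sum_l invmx MS i l *: \sum_j M l j *: tnth [tuple of e ++ f ++ g] j.
    under [RHS]eq_bigr do rewrite scaler_sumr.
    rewrite exchange_big /=; apply: eq_bigr => j _.
    by rewrite mxE scaler_suml; apply: eq_bigr => l _; rewrite scalerA.
  apply: memv_suml => l _; apply: memvZ; apply: (basis_mem M_basis).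
  exact: map_f (mem_enum _ _).
have NS : colsub (chart_col (odd (\dim {:V})) S) N = 1%:M.
  rewrite -(mulVmx MSu); apply/matrixP => i j.
  by rewrite !mxE; apply: eq_bigr => l _; rewrite !mxE.
set A := colsub (chart_col (odd (\dim {:V})) (~: S)) N.
have minorE D : plucker_minor M (symdiff S D) = \det MS * \det (fill_id A D).
  by rewrite -plucker_minor_chart // plucker_minor_mul det_inv mulVKf.
(* Toggling [i] in [S] changes the linear part of the tilt by [- w i]; with this sign, comparing
   tilts amounts to comparing a principal minor with its weight. *)
pose w i := if i \in S then c i else - c i.
have tiltE D : \det (fill_id A D) != 0 ->
    tilted (fun U => nu (plucker_minor M U)) c (symdiff S D) =
    tilted (fun U => nu (plucker_minor M U)) c S
      - \sum_(i in D) w i + fine (nu (\det (fill_id A D))).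
  move=> AD0; rewrite /tilted minorE Defs.valM fineD ?val_fin_num //.
  rewrite sum_symdiff -[plucker_minor M S]/(\det MS).
  have -> : \sum_(i in D) (if i \in S then - c i else c i) = - \sum_(i in D) w i.
    by rewrite -sumrN; apply: eq_bigr => i _; rewrite /w; case: ifP; rewrite ?opprK.
  by ring.
have gt_minor (D : {set 'I_n}) : (0 < #|D| <= 2)%N ->
    ((\sum_(i in D) w i)%:E < nu (\det (fill_id A D)))%E.
  move=> /andP[D0 D2].
  have [->|AD0] := eqVneq (\det (fill_id A D)) 0; first by rewrite val_zero ltry.
  (* A nonempty [D] with at most two elements moves [S] neither to itself nor to [T], which is at
     distance at least 3; strict minimality then applies. *)
  have symS : symdiff S D != S.
    apply: contraTneq D0 => SD; rewrite -leqNgt leqn0 cards_eq0.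
    rewrite -(symdiffK S D) SD; apply/eqP/setP => i.
    by rewrite !inE addbb.
  have symT : symdiff S D != T.
    by apply: contraTneq D3 => <-; rewrite symdiffK -leqNgt.
  have pD : nu (plucker_minor M (symdiff S D)) != +oo%E.
    rewrite minorE; apply/eqP => /val_eq_pinfty/eqP.
    by rewrite mulf_eq0 (negbTE MS0) (negbTE AD0).
  have := cmin _ pD symS symT; rewrite tiltE // => lt_w.
  rewrite -(fineK (val_fin_num nu AD0)) lte_fin; lra.
have gt1 i : ((w i)%:E < nu (A i i))%E.
  by have := gt_minor [set i]; rewrite cards1 big_set1 det_fill_id1 => ->.
have gt2 i j : i != j -> ((w i + w j)%:E < nu (A i i * A j j - A i j * A j i)%R)%E.
  move=> ij; have := gt_minor [set i; j].
  by rewrite cards2 ij big_setU1 ?inE //= big_set1 det_fill_id2 // => ->.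
have gtA := val_gt_offdiag nu_sigma dim_hermitian basis_efg L_iso NL NS gt1 gt2.
pose D := symdiff S T; have [j0 j0D] : exists j, j \in D.
  by apply/card_gt0P; apply: leq_trans D3.
(* Outside [D] the weights of row and column cancel, matching the entry 1. *)
pose col j := if j \in D then w j / 2 else - (w j / 2).
have gt_col i j : j \in D -> ((w i / 2 + col j)%:E < nu (fill_id A D i j))%E.
  by move=> jD; rewrite mxE /col jD -mulrDl; apply: gtA.
have ge_col i j : ((w i / 2 + col j)%:E <= nu (fill_id A D i j))%E.
  have [jD|jD] := boolP (j \in D); first exact/ltW/gt_col.
  rewrite mxE /col (negbTE jD); case: eqP => [->|_]; last by rewrite val_zero leey.
  by rewrite subrr val_unit_sqr ?mulr1.
have := val_gt_det ge_col (fun i => gt_col i j0 j0D).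
have -> : \sum_i w i / 2 + \sum_j col j = \sum_(i in D) w i.
  rewrite -big_split [RHS]big_mkcond; apply: eq_bigr => i _ /=.
  by rewrite /col; case: ifP => _; [rewrite -splitr|rewrite subrr].
have AD0 : \det (fill_id A D) != 0.
  have := pT; rewrite -{1}(symdiffK S T) minorE; apply: contraNneq => ->.
  by rewrite mulr0 val_zero.
(* Equal tilts at [S] and [T] force the minor on [D] to have valuation exactly the sum of [w] over
   [D], against the strict bound from the Leibniz expansion. *)
have := tiltE _ AD0; rewrite symdiffK -cST => tE.
by rewrite -(fineK (val_fin_num nu AD0)) lte_fin; lra.
Qed.
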